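(* Let $n$ be a positive integer, let $P\in\mathbb{C}^{n\times n}$ be a projection and let $Q\in\mathbb{C}^{n\times n}$ be an idempotent such that $PQ=Q$. Then $$\|P-Q\|_F\le \sqrt{2}\cdot\lambda_{P,Q},\qquad\text{where}\quad \lambda_{P,Q}=\sqrt{\|m(Q)-Q\|_F^2+\mathrm{rank}(P)-\mathrm{rank}(Q)}$$ and $m(Q)$ is the matched projection of $Q$. Moreover, equality $\|P-Q\|_F=\sqrt{2}\cdot\lambda_{P,Q}$ occurs if and only if $P=Q=P_{\mathcal{R}(Q)}$.
   Context: An idempotent is a matrix $Q$ with $Q^2=Q$; a projection is a Hermitian idempotent ($P=P^*=P^2$). $\mathcal{R}(Q)$ is the column range of $Q$ and $P_{\mathcal{R}(Q)}$ is the (orthogonal) projection from $\mathbb{C}^n$ onto $\mathcal{R}(Q)$. $\|\cdot\|_F$ is the Frobenius norm, $A^*$ the conjugate transpose, $A^\dag$ the Moore-Penrose inverse, and $|A|=(A^*A)^{1/2}$ the positive semi-definite square root, so $|Q^*|=(QQ^* )^{1/2}$. For an idempotent $Q\in\mathbb{C}^{n\times n}$ the matched projection is $$m(Q)=\tfrac12\big(|Q^*|+Q^*\big)\,|Q^*|^\dag\,\big(|Q^*|+I_n\big)^{-1}\big(|Q^*|+Q\big),$$ which is known to be a projection. *)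

(* Defs.v *)
From mathcomp Require Import all_boot all_order all_algebra.
From mathcomp Require Import spectral.
From mathcomp Require Import complex.
From mathcomp Require Import boolp classical_sets reals.

Set Implicit Arguments.
Unset Strict Implicit.
Unset Printing Implicit Defensive.

Import Order.TTheory GRing.Theory Num.Theory.
Local Open Scope ring_scope.
Local Open Scope sesquilinear_scope.

Section MatrixNotions.
Context {C : numClosedFieldType}.

Definition idempotentmx n (Q : 'M[C]_n) : Prop := Q *m Q = Q.

Definition projectionmx n (P : 'M[C]_n) : Prop :=
  P ^t* = P /\ idempotentmx P.

(* [proj_ortho] acts on row vectors, from the right, and projects onto the row
   space; hence the two transpositions; see [range_projP]. *)
Definition range_proj n (Q : 'M[C]_n) : 'M[C]_n := (proj_ortho Q^T)^T.

Definition psdmx n (A : 'M[C]_n) : Prop :=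
  A ^t* = A /\ forall x : 'cV[C]_n, 0 <= (x ^t* *m A *m x) 0 0.

(* The positive semi-definite square root of A, junk if A is not psd; see
   [psd_sqrtmxP] and [psd_sqrt_unique]. *)
Definition psd_sqrtmx n (A : 'M[C]_n) : 'M[C]_n :=
  xget 0 [set B | psdmx B /\ B *m B = A]%classic.

Definition absmx n (A : 'M[C]_n) : 'M[C]_n := psd_sqrtmx (A ^t* *m A).

Definition penrose m n (A : 'M[C]_(m, n)) (X : 'M[C]_(n, m)) : Prop :=
  [/\ A *m X *m A = A, X *m A *m X = X,
      (A *m X) ^t* = A *m X & (X *m A) ^t* = X *m A].

(* The Moore-Penrose inverse; see [mpinvP] and [penrose_unique]. *)
Definition mpinv m n (A : 'M[C]_(m, n)) : 'M[C]_(n, m) :=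
  xget 0 [set X | penrose A X]%classic.

Definition matched_proj n (Q : 'M[C]_n) : 'M[C]_n :=
  2^-1 *: ((absmx (Q ^t*) + Q ^t*) *m mpinv (absmx (Q ^t*))
           *m invmx (absmx (Q ^t*) + 1%:M) *m (absmx (Q ^t*) + Q)).

Lemma trmxC_mul m n p (A : 'M[C]_(m, n)) (B : 'M[C]_(n, p)) :
  (A *m B) ^t* = B ^t* *m A ^t*.
Proof. by rewrite trmx_mul map_mxM. Qed.

Lemma row_mul_trmxC_eq0 n (v : 'rV[C]_n) : (v *m v ^t*) 0 0 = 0 -> v = 0.
Proof.
rewrite mxE => s0; apply/rowP => i; rewrite mxE.
have ge0 j : true -> 0 <= v 0 j * (v ^t*) j 0.
  by move=> _; rewrite !mxE mul_conjC_ge0.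
have := psumr_eq0P ge0 s0 (i := i) isT.
by rewrite !mxE => /eqP; rewrite mul_conjC_eq0 => /eqP.
Qed.

Lemma row_free_gram m n (M : 'M[C]_(m, n)) :
  row_free M -> M *m M ^t* \in unitmx.
Proof.
move=> fM; rewrite -row_free_unit; apply/row_freeP.
apply/row_freeP; rewrite -kermx_eq0; apply/eqP/row_matrixP => i.
rewrite row0; set v := row i _.
have v0 : v *m (M *m M ^t*) = 0.
  by rewrite /v -row_mul mulmx_ker row0.
have : v *m M = 0.
  apply: row_mul_trmxC_eq0.
  by rewrite trmxC_mul mulmxA -(mulmxA v) v0 mul0mx mxE.
by move/eqP; rewrite mulmx_free_eq0 // => /eqP.
Qed.

Lemma penrose_exists m n (A : 'M[C]_(m, n)) : exists X, penrose A X.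
Proof.
suff H r (F : 'M[C]_(m, r)) (G : 'M[C]_(r, n)) :
    row_full F -> row_free G -> exists X, penrose (F *m G) X.
  rewrite -(mulmx_base A); apply: H.
    exact: col_base_full.
  exact: row_base_free.
move=> fF fG; set S := G *m G ^t*; set T := F ^t* *m F.
have uS : S \in unitmx by apply: row_free_gram.
have uT : T \in unitmx.
  have : F ^t* *m (F ^t*) ^t* \in unitmx.
    by apply: row_free_gram; rewrite /row_free mxrank_map mxrank_tr.
  by rewrite trmxCK.
have hS : S ^t* = S by rewrite trmxC_mul trmxCK.
have hT : T ^t* = T by rewrite trmxC_mul trmxCK.
have hiS : (invmx S) ^t* = invmx S by rewrite trmx_inv map_invmx hS.
have hiT : (invmx T) ^t* = invmx T by rewrite trmx_inv map_invmx hT.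
set X := G ^t* *m invmx S *m (invmx T *m F ^t*).
have AX : F *m G *m X = F *m invmx T *m F ^t*.
  by rewrite /X !mulmxA -(mulmxA F G) -/S mulmxK.
have XA : X *m (F *m G) = G ^t* *m invmx S *m G.
  by rewrite /X !mulmxA -(mulmxA _ (F ^t*) F) -/T mulmxKV.
exists X; split.
- by rewrite AX !mulmxA -(mulmxA _ (F ^t*) F) -/T mulmxKV.
- by rewrite XA /X !mulmxA -(mulmxA _ G (G ^t*)) -/S mulmxKV.
- by rewrite AX !trmxC_mul trmxCK hiT mulmxA.
- by rewrite XA !trmxC_mul trmxCK hiS mulmxA.
Qed.

Lemma penrose_unique m n (A : 'M[C]_(m, n)) X Y :
  penrose A X -> penrose A Y -> X = Y.
Proof.
move=> [AXA XAX hAX hXA] [AYA YAY hAY hYA].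
have e1 : A *m X = A *m Y.
  rewrite -[LHS]hAX -{1}AYA -!mulmxA mulmxA trmxC_mul hAX hAY.
  by rewrite !mulmxA AXA.
have e2 : X *m A = Y *m A.
  rewrite -[LHS]hXA -{1}AYA -mulmxA mulmxA trmxC_mul hYA.
  by rewrite hXA -!mulmxA [A *m (X *m A)]mulmxA AXA.
by rewrite -XAX -mulmxA e1 mulmxA e2 YAY.
Qed.

Lemma mpinvP m n (A : 'M[C]_(m, n)) : penrose A (mpinv A).
Proof. by have [X] := penrose_exists A; exact: xgetI. Qed.

Lemma psdmx_spectral n (A : 'M[C]_n) : psdmx A ->
  A = (spectralmx A) ^t* *m diag_mx (spectral_diag A) *m spectralmx A
  /\ forall i, 0 <= spectral_diag A 0 i.
Proof.
move=> [hA pA]; set U := spectralmx A; set d := spectral_diag A.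
have uU : U \is unitarymx := spectral_unitarymx A.
have AE : A = U ^t* *m diag_mx d *m U.
  have /orthomx_spectralP : A \is normalmx by apply/normalmxP; rewrite hA.
  by rewrite -/U -/d invmx_unitary.
split=> // i.
have := pA (U ^t* *m delta_mx i 0).
rewrite trmxC_mul trmxCK {1}AE !mulmxA.
rewrite -(mulmxA _ U (U ^t*)) (unitarymxP uU) mulmx1.
rewrite -(mulmxA _ U (U ^t*)) (unitarymxP uU) mulmx1.
rewrite trmx_delta map_delta_mx -rowE -colE !mxE eqxx mulr1n.
by [].
Qed.

Lemma psd_sqrt_exists n (A : 'M[C]_n) : psdmx A ->
  exists B, psdmx B /\ B *m B = A.
Proof.
move=> /psdmx_spectral[]; set U := spectralmx A; set d := spectral_diag A.
have uU : U *m U ^t* = 1%:M by apply/unitarymxP/spectral_unitarymx.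
move=> AE d0; set e := \row_i sqrtC (d 0 i).
have e0 i : 0 <= e 0 i by rewrite mxE sqrtC_ge0.
exists (U ^t* *m diag_mx e *m U); split; last first.
  rewrite !mulmxA -(mulmxA _ U (U ^t*)) uU mulmx1 [RHS]AE.
  congr (_ *m _); rewrite -mulmxA mulmx_diag; congr (_ *m diag_mx _).
  by apply/rowP => i; rewrite !mxE -expr2 sqrtCK.
split.
  rewrite !trmxC_mul trmxCK mulmxA tr_diag_mx map_diag_mx.
  congr (_ *m diag_mx _ *m _); apply/rowP => i.
  by rewrite mxE; apply/CrealP/ger0_real.
move=> x; set y := U *m x.
have -> : x ^t* *m (U ^t* *m diag_mx e *m U) *m x = y ^t* *m diag_mx e *m y.
  by rewrite trmxC_mul !mulmxA.
move: y => y; rewrite mxE sumr_ge0 // => i _.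
rewrite mul_mx_diag mxE [(y ^t*) _ _]mxE [y^T _ _]mxE mulrAC mulr_ge0 //.
by rewrite mulrC mul_conjC_ge0.
Qed.

Lemma psd_sqrt_unique n (B B' : 'M[C]_n) :
  psdmx B -> psdmx B' -> B *m B = B' *m B' -> B = B'.
Proof.
move=> /psdmx_spectral[BE d0] /psdmx_spectral[BE' d0'].
have uU := unitarymxP (spectral_unitarymx B).
have uV := unitarymxP (spectral_unitarymx B').
move: BE d0 BE' d0' uU uV.
move: (spectralmx B) (spectral_diag B) (spectralmx B') (spectral_diag B').
move=> U d V e BE d0 BE' e0 uU uV BB.
have uU' : U ^t* *m U = 1%:M by apply: mulmx1C.
have uV' : V ^t* *m V = 1%:M by apply: mulmx1C.
set W := U *m V ^t*.
have sqB : U *m (B *m B) *m V ^t* = diag_mx d *m (diag_mx d *m W).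
  rewrite BE /W !mulmxA uU mul1mx -(mulmxA _ U (U ^t*)) uU mulmx1.
  by rewrite -!mulmxA.
have sqB' : U *m (B' *m B') *m V ^t* = W *m diag_mx e *m diag_mx e.
  rewrite BE' /W !mulmxA -(mulmxA _ V (V ^t*)) uV mulmx1.
  by rewrite -(mulmxA _ V (V ^t*)) uV mulmx1.
have DW : diag_mx d *m W = W *m diag_mx e.
  have : diag_mx d *m (diag_mx d *m W) = W *m diag_mx e *m diag_mx e.
    by rewrite -sqB BB.
  clear sqB sqB'; move: W => W DDW; apply/matrixP => i j.
  move/matrixP/(_ i j): DDW; rewrite !mul_diag_mx !mul_mx_diag !mxE.
  have [->|W0] := eqVneq (W i j) 0; first by rewrite !mulr0 !mul0r.
  rewrite mulrA -[RHS]mulrA [RHS]mulrC => /(mulIf W0)/eqP.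
  by rewrite -!expr2 eqrXn2 // => /eqP ->; rewrite mulrC.
rewrite BE BE' -[LHS]mulmx1 -uV' !mulmxA -(mulmxA _ U (V ^t*)) -/W.
by rewrite -(mulmxA _ _ W) DW /W !mulmxA uU' mul1mx.
Qed.

Lemma psd_sqrtmxP n (A : 'M[C]_n) : psdmx A ->
  psdmx (psd_sqrtmx A) /\ psd_sqrtmx A *m psd_sqrtmx A = A.
Proof.
move=> /psd_sqrt_exists[B hB].
exact: (@xgetI _ 0 [set D | psdmx D /\ D *m D = A]%classic B hB).
Qed.

Lemma psdmx_gram m n (A : 'M[C]_(m, n)) : psdmx (A ^t* *m A).
Proof.
split=> [|x]; first by rewrite trmxC_mul trmxCK.
rewrite mulmxA -mulmxA -trmxC_mul mxE sumr_ge0 // => i _.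
by rewrite !mxE mulrC mul_conjC_ge0.
Qed.

Lemma absmxP n (A : 'M[C]_n) :
  psdmx (absmx A) /\ absmx A *m absmx A = A ^t* *m A.
Proof. by apply: psd_sqrtmxP; apply: psdmx_gram. Qed.

Lemma range_projP n (Q : 'M[C]_n) :
  projectionmx (range_proj Q) /\ ((range_proj Q)^T :=: Q^T)%MS.
Proof.
rewrite /range_proj; set p := proj_ortho Q^T.
have pp : p *m p = p by exact: proj_ortho_proj.
have pc : (1%:M - p) *m p ^t* = 0.
  have /orthomx1P := proj_ortho_compl_sub Q^T (1%:M : 'M[C]_n).
  rewrite mul1mx -/p => pQ.
  have /submxP[D pD] : (p <= Q^T)%MS by rewrite proj_orthoE.
  by rewrite {2}pD trmxC_mul mulmxA pQ mul0mx.
have pQ : (p :=: Q^T)%MS by exact: proj_orthoE.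
clearbody p.
have hp : p ^t* = p *m p ^t*.
  by apply/eqP; rewrite -subr_eq0 -{1}[p ^t*]mul1mx -mulmxBl pc.
split; last by rewrite trmxK.
split; last by rewrite /idempotentmx -trmx_mul pp.
have : p ^t* = p by rewrite -[RHS]trmxCK [in RHS]hp trmxC_mul trmxCK -hp.
by move=> {2}<-; rewrite map_trmx trmxK.
Qed.

End MatrixNotions.

Section Frobenius.
Context {R : realType}.

Definition frobnorm m n (A : 'M[R[i]]_(m, n)) : R :=
  Num.sqrt (\sum_(i < m) \sum_(j < n) ComplexField.Normc.normc (A i j) ^+ 2).

Definition lambda_PQ n (P Q : 'M[R[i]]_n) : R :=
  Num.sqrt (frobnorm (matched_proj Q - Q) ^+ 2
            + (\rank P)%:R - (\rank Q)%:R).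

End Frobenius.

(* Main.v *)
(** Write [B = |Q^*|] and let [E = B B^dagger] be the projection onto the range
    of [Q].  From [B^2 = Q Q^*] one gets [Q B = B], and then [m(Q)] is a
    projection with [tr m(Q) = tr E = rank Q] and
    [2 tr (m(Q) Q) = tr B + rank Q].  Hence
    [|P - Q|^2 = tr B^2 + rank P - 2 rank Q], [|m(Q) - Q|^2 = tr B^2 - tr B], and
    [2 lambda^2 - |P - Q|^2 = |B - E|^2 + |P - E|^2]. *)
Require Import Defs.
From mathcomp Require Import all_boot all_order all_algebra.
From mathcomp Require Import complex reals spectral ring.

Import Order.TTheory GRing.Theory Num.Theory.
Local Open Scope ring_scope.
Local Open Scope sesquilinear_scope.

(** In a full-rank factorization [A = c r], cancelling [c] on the left and [r] on the right of
    [A A = A] leaves [r c = 1], an identity of size [rank A] with the same trace as [c r]. *)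
Lemma mxtrace_idempotent (F : fieldType) n (A : 'M[F]_n) :
  A *m A = A -> \tr A = (\rank A)%:R.
Proof.
move=> AA; rewrite -{1}(mulmx_base A) mxtrace_mulC.
suff rc k (c : 'M[F]_(n, k)) (r : 'M[F]_(k, n)) : row_full c -> row_free r ->
    c *m r *m (c *m r) = c *m r -> r *m c = 1%:M.
  by rewrite rc ?mxtrace1 ?col_base_full ?row_base_free // mulmx_base.
move=> /row_fullP[G Gc] /row_freeP[D rD] /(congr1 (fun X => G *m X *m D)).
by rewrite !mulmxA Gc !mul1mx rD -mulmxA rD mulmx1.
Qed.

(** * Trace form, pseudo-inverses and range projections *)

Section HilbertSchmidt.
Context {C : numClosedFieldType}.

Lemma trmxCD m n (A B : 'M[C]_(m, n)) : (A + B) ^t* = A ^t* + B ^t*.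
Proof. by rewrite !raddfD. Qed.

Lemma trmxCB m n (A B : 'M[C]_(m, n)) : (A - B) ^t* = A ^t* - B ^t*.
Proof. by rewrite !raddfB. Qed.

Lemma mxtrace_trmxC n (A : 'M[C]_n) : \tr (A ^t*) = (\tr A)^*.
Proof. by rewrite -map_trmx mxtrace_tr trace_map_mx. Qed.

Lemma mxtrace_gramE m n (A : 'M[C]_(m, n)) :
  \tr (A *m A ^t*) = \sum_i \sum_j `|A i j| ^+ 2.
Proof.
by apply: eq_bigr => i _; rewrite mxE; apply: eq_bigr => j _; rewrite !mxE normCK.
Qed.

Lemma mxtrace_gram_ge0 m n (A : 'M[C]_(m, n)) : 0 <= \tr (A *m A ^t*).
Proof.
by rewrite mxtrace_gramE; do 2!apply: sumr_ge0 => ? _; exact: exprn_ge0.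
Qed.

Lemma mxtrace_gram_eq0 m n (A : 'M[C]_(m, n)) : \tr (A *m A ^t*) = 0 -> A = 0.
Proof.
rewrite mxtrace_gramE => A0; apply/matrixP => i j; rewrite mxE.
have ge0 k l : 0 <= `|A k l| ^+ 2 by exact: exprn_ge0.
have Ai := psumr_eq0P (fun k _ => sumr_ge0 _ (fun l _ => ge0 k l)) A0 (i := i) isT.
have /eqP := psumr_eq0P (fun l _ => ge0 i l) Ai (i := j) isT.
by rewrite expf_eq0 /= normr_eq0 => /eqP.
Qed.

Lemma gram_eq0 m n (A : 'M[C]_(m, n)) : A *m A ^t* = 0 -> A = 0.
Proof. by move=> A0; apply: mxtrace_gram_eq0; rewrite A0 mxtrace0. Qed.

(** The adjoint of [mpinv A] again satisfies the four Penrose equations for [A], so uniqueness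
    applies. *)
Lemma mpinv_hermitian n (A : 'M[C]_n) : A ^t* = A -> (mpinv A) ^t* = mpinv A.
Proof.
move=> hA; have [AXA XAX hAX hXA] := mpinvP A.
apply: (@penrose_unique _ _ _ A); last exact: mpinvP.
split.
- by rewrite -[RHS]hA -[in RHS]AXA !trmxC_mul hA mulmxA.
- by rewrite -[in RHS]XAX !trmxC_mul hA mulmxA.
- by rewrite trmxC_mul trmxCK hA -hXA trmxC_mul hA.
- by rewrite trmxC_mul trmxCK hA -hAX trmxC_mul hA.
Qed.

(** A kernel vector would be an eigenvector of [A] for -1, against positivity. The transpose appears
    because [kermx] is a left kernel. *)
Lemma psdmxD1_unit n (A : 'M[C]_n) : psdmx A -> A + 1%:M \in unitmx.
Proof.
move=> [hA pA]; rewrite -unitmx_tr -row_free_unit -kermx_eq0.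
apply/eqP/row_matrixP => i; rewrite row0; set v := row i _.
have v0 : v *m (A + 1%:M)^T = 0 by rewrite /v -row_mul mulmx_ker row0.
have Av : A *m v^T = - v^T.
  apply/eqP; rewrite -addr_eq0; apply/eqP.
  by rewrite -[X in _ + X]mul1mx -mulmxDl -[LHS]trmxK trmx_mul trmxK v0 trmx0.
have := pA v^T; rewrite -mulmxA Av mulmxN mxE oppr_ge0 => le0.
have vv : v^T ^t* *m v^T = 0.
  apply/matrixP => a b; rewrite !ord1 [RHS]mxE; apply/le_anti.
  by rewrite le0 mxE sumr_ge0 // => j _; rewrite !mxE mulrC mul_conjC_ge0.
have w0 : v^T ^t* = 0 by apply: gram_eq0; rewrite trmxCK.
by rewrite -[LHS]trmxK -[v^T]trmxCK w0 trmx0 map_mx0 trmx0.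
Qed.

(** Idempotents with the same column space fix each other: [Q E = E] and [E Q = Q]. The adjoint of
    the first is [E Q = E]. *)
Lemma range_proj_projection n (Q : 'M[C]_n) :
  projectionmx Q -> range_proj Q = Q.
Proof.
move=> [hQ QQ]; have [[hE EE] EQ] := range_projP Q.
move: (range_proj Q) hE EE EQ => E hE EE EQ.
have fixr (A B : 'M[C]_n) : idempotentmx A -> (B^T <= A^T)%MS -> A *m B = B.
  move=> AA /submxP[D BD]; rewrite -[B]trmxK BD trmx_mul trmxK.
  by rewrite mulmxA AA.
have QE : Q *m E = E by apply: fixr => //; rewrite EQ.
have E_Q : E *m Q = Q by apply: fixr => //; rewrite EQ.
by rewrite -[LHS]hE -QE trmxC_mul hE hQ E_Q.
Qed.

(** * The matched projection of one idempotent *)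

Section MatchedProjection.
Context {n : nat} {Q : 'M[C]_n} (hQ : idempotentmx Q).
Let B := absmx (Q ^t*).
Let M := mpinv B.
Let K := invmx (B + 1%:M).
Let E := B *m M.
Let m := matched_proj Q.

Let psdB : psdmx B. Proof. by have [] := absmxP (Q ^t*). Qed.
Let hB : B ^t* = B. Proof. by have [] := psdB. Qed.
Let BB : B *m B = Q *m Q ^t*.
Proof. by have [_] := absmxP (Q ^t*); rewrite trmxCK. Qed.

(** The Gram matrix of [(Q - 1) B] contains the factor [(Q - 1) B B = (Q - 1) Q Q ^t* = 0]. *)
Let QB : Q *m B = B.
Proof.
apply/eqP; rewrite -subr_eq0 -[X in _ - X]mul1mx -mulmxBl; apply/eqP/gram_eq0.
rewrite trmxC_mul hB mulmxA -(mulmxA _ B B) BB mulmxA.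
by rewrite mulmxBl hQ mul1mx subrr !mul0mx.
Qed.

Let BQC : B *m Q ^t* = B.
Proof. by rewrite -{1}hB -trmxC_mul QB hB. Qed.

Let hM : M ^t* = M. Proof. exact: mpinv_hermitian. Qed.
Let BM : B *m M = M *m B.
Proof. by have [_ _ <- _] := mpinvP B; rewrite trmxC_mul hB hM. Qed.
Let MBM : M *m B *m M = M. Proof. by have [] := mpinvP B. Qed.

Let uB : B + 1%:M \in unitmx. Proof. exact: psdmxD1_unit. Qed.
Let hK : K ^t* = K.
Proof. by rewrite trmx_inv map_invmx trmxCD hB trmx1 map_mx1. Qed.
Let MK : M *m K = K *m M.
Proof.
rewrite -[M in LHS](mulKmx uB) -/K mulmxDl mul1mx BM -{2}[M]mulmx1 -mulmxDr.
by rewrite !mulmxA mulmxK.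
Qed.

Let EB : E *m B = B. Proof. by have [] := mpinvP B. Qed.
Let hE : E ^t* = E. Proof. by have [] := mpinvP B. Qed.
Let EE : E *m E = E. Proof. by rewrite /E mulmxA EB. Qed.
Let QE : Q *m E = E. Proof. by rewrite /E mulmxA QB. Qed.

(** The same Gram argument read backwards: [(E - 1) Q Q ^t* = (E - 1) B B = 0]. Together with [QE]
    it shows that [E] and [Q] have the same range. *)
Let EQ : E *m Q = Q.
Proof.
apply/eqP; rewrite -subr_eq0 -[X in _ - X]mul1mx -mulmxBl; apply/eqP/gram_eq0.
rewrite trmxC_mul mulmxA -(mulmxA _ Q) -BB mulmxA.
by rewrite mulmxBl EB mul1mx subrr !mul0mx.
Qed.

Let trE : \tr E = (\rank Q)%:R.
Proof. by rewrite -QE mxtrace_mulC EQ mxtrace_idempotent. Qed.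

Let mE : m = 2^-1 *: ((B + Q ^t*) *m (M *m K) *m (B + Q)).
Proof. by rewrite /m /matched_proj -!mulmxA. Qed.

(** Each of the four products is [B B] or [B], so the outer factors of [m] multiply to a polynomial
    in [B]. *)
Let sandwich : (B + Q) *m (B + Q ^t*) = 2 *: (B *m (B + 1%:M)).
Proof.
rewrite mulmxDl !mulmxDr QB BQC -BB mulmx1 scalerDr !scaler_nat !mulr2n.
by rewrite [B + _]addrC addrACA.
Qed.

(** Up to the factor 2, [M K] inverts the product in [sandwich] on the range of [Q]. This collapse
    gives both the idempotence of [m] and its traces. *)
Let MKB : M *m K *m (B *m (B + 1%:M)) = E.
Proof.
have -> : B *m (B + 1%:M) = (B + 1%:M) *m B by rewrite mulmxDr mulmxDl mul1mx mulmx1.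
by rewrite mulmxA mulmxKV // -BM.
Qed.

Let hm : m ^t* = m.
Proof.
rewrite mE [in LHS]linearZ /= map_mxZ !trmxC_mul !trmxCD hB trmxCK hM hK -MK mulmxA.
by rewrite fmorphV rmorph_nat !mulmxA.
Qed.

Lemma matched_proj_projection : projectionmx m.
Proof.
split=> //; rewrite /idempotentmx mE -scalemxAl -scalemxAr.
have -> : (B + Q ^t*) *m (M *m K) *m (B + Q) *m ((B + Q ^t*) *m (M *m K) *m (B + Q))
  = (B + Q ^t*) *m (M *m K *m ((B + Q) *m (B + Q ^t*)) *m (M *m K)) *m (B + Q).
  by rewrite !mulmxA.
rewrite sandwich -scalemxAr MKB -scalemxAl [E *m _]mulmxA [E in E *m M]BM MBM.
by rewrite -scalemxAr -scalemxAl !scalerA -mulrA mulVf ?mulr1 // pnatr_eq0.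
Qed.

Let tr_m : \tr m = (\rank Q)%:R.
Proof.
rewrite mE linearZ /= -mulmxA mxtrace_mulC -[M *m K *m _ *m _]mulmxA sandwich -scalemxAr MKB.
by rewrite linearZ /= mulrA mulVf ?mul1r // pnatr_eq0.
Qed.

Let tr_mQ : \tr (m *m Q) = 2^-1 * (\tr B + (\rank Q)%:R).
Proof.
rewrite mE -scalemxAl linearZ /=; congr (_ * _).
rewrite -!mulmxA mxtrace_mulC -!mulmxA [M *m _]mulmxA.
(* Inserting [Q] replaces the 2 of [sandwich] by [B + 1], so the trace reduces to that of
   [E (B + 1)]. *)
have -> : (B + Q) *m (Q *m (B + Q ^t*)) = B *m (B + 1%:M) *m (B + 1%:M).
  rewrite mulmxDr QB -BB mulmxDl !mulmxDr !mulmx1 !mulmxDl !mulmxA QB.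
  by congr (_ + _); rewrite addrC.
by rewrite mulmxA MKB mulmxDr EB mulmx1 linearD /= trE.
Qed.

Let conj_trB : (\tr B)^* = \tr B.
Proof. by rewrite -mxtrace_trmxC hB. Qed.

Lemma mxtrace_gram_matched_projB :
  \tr ((m - Q) *m (m - Q) ^t*) = \tr (B *m B) - \tr B.
Proof.
rewrite trmxCB hm mulmxBl !mulmxBr (matched_proj_projection).2 -BB.
rewrite !linearB /= tr_m [\tr (Q *m m)]mxtrace_mulC tr_mQ.
(* This is the conjugate of [tr (m Q)], which is real because [B] is Hermitian. *)
have -> : \tr (m *m Q ^t*) = 2^-1 * (\tr B + (\rank Q)%:R).
  rewrite mxtrace_mulC -{1}hm -trmxC_mul mxtrace_trmxC tr_mQ.
  by rewrite rmorphM rmorphD fmorphV /= !rmorph_nat conj_trB.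
by field.
Qed.

(** * A projection dominating the idempotent *)

Section Dominating.
Context {P : 'M[C]_n} (hP : projectionmx P) (PQ : P *m Q = Q).

Let PE : P *m E = E. Proof. by rewrite -QE mulmxA PQ. Qed.
Let EP : E *m P = E.
Proof. by rewrite -{1}hE -{1}hP.1 -trmxC_mul PE hE. Qed.

(** As [P] dominates [E], the difference [P - E] is itself a projection. *)
Let gramPE : \tr ((P - E) *m (P - E) ^t*) = (\rank P)%:R - (\rank Q)%:R.
Proof.
rewrite trmxCB hP.1 hE mulmxBl !mulmxBr hP.2 PE EP EE subrr subr0 linearB /= trE.
by rewrite mxtrace_idempotent //; exact: hP.2.
Qed.

Let gramBE :
  \tr ((B - E) *m (B - E) ^t*) = \tr (B *m B) - 2 * \tr B + (\rank Q)%:R.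
Proof.
rewrite trmxCB hB hE mulmxBl !mulmxBr EB EE !linearB /= trE.
by rewrite [\tr (B *m E)]mxtrace_mulC EB; ring.
Qed.

Lemma mxtrace_gram_dominatingB : \tr ((P - Q) *m (P - Q) ^t*) =
  \tr (B *m B) + (\rank P)%:R - 2 * (\rank Q)%:R.
Proof.
rewrite trmxCB hP.1 mulmxBl !mulmxBr hP.2 -BB !linearB /=.
rewrite [\tr (Q *m P)]mxtrace_mulC PQ.
have -> : P *m Q ^t* = (Q *m P) ^t* by rewrite trmxC_mul hP.1.
rewrite mxtrace_trmxC [\tr (Q *m P)]mxtrace_mulC PQ.
have PP := hP.2; rewrite (mxtrace_idempotent _ _ P) // (mxtrace_idempotent _ _ Q) // rmorph_nat.
by ring.
Qed.

Lemma matched_proj_gap :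
  2 * (\tr ((m - Q) *m (m - Q) ^t*) + (\rank P)%:R - (\rank Q)%:R)
    - \tr ((P - Q) *m (P - Q) ^t*)
  = \tr ((B - E) *m (B - E) ^t*) + \tr ((P - E) *m (P - E) ^t*).
Proof.
rewrite mxtrace_gram_matched_projB mxtrace_gram_dominatingB gramPE gramBE.
by ring.
Qed.

(** Needed since the real square root is 0 on negative numbers. The rank difference is the squared
    norm of [P - E]. *)
Lemma matched_proj_lambda_ge0 :
  0 <= \tr ((m - Q) *m (m - Q) ^t*) + (\rank P)%:R - (\rank Q)%:R.
Proof. by rewrite -addrA -gramPE addr_ge0 // mxtrace_gram_ge0. Qed.

Lemma matched_proj_bound : \tr ((P - Q) *m (P - Q) ^t*) <=
  2 * (\tr ((m - Q) *m (m - Q) ^t*) + (\rank P)%:R - (\rank Q)%:R).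
Proof.
by rewrite -subr_ge0 matched_proj_gap addr_ge0 // mxtrace_gram_ge0.
Qed.

(** At equality both Gram traces of the gap vanish, forcing [B = E] and [P = E]. Conversely, [P = Q]
    makes both sides zero. *)
Lemma matched_proj_bound_eq : \tr ((P - Q) *m (P - Q) ^t*) =
    2 * (\tr ((m - Q) *m (m - Q) ^t*) + (\rank P)%:R - (\rank Q)%:R)
  <-> P = Q /\ Q = range_proj Q.
Proof.
split=> [gap|[eqPQ _]].
  have /eqP := matched_proj_gap.
  rewrite -gap subrr eq_sym paddr_eq0 ?mxtrace_gram_ge0 //.
  move=> /andP[/eqP/mxtrace_gram_eq0/subr0_eq eqBE /eqP/[dup] rPQ].
  move=> /mxtrace_gram_eq0/subr0_eq eqPE.
  (* With [B = E] and equal ranks [r], the squared distance is [r + r - 2 r]. *)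
  suff PQ0 : \tr ((P - Q) *m (P - Q) ^t*) = 0.
    move/mxtrace_gram_eq0/subr0_eq: PQ0 => eqPQ; split=> //.
    by rewrite range_proj_projection // -eqPQ.
  rewrite mxtrace_gram_dominatingB eqBE EE trE.
  have -> : (\rank P)%:R = (\rank Q)%:R :> C.
    by apply/eqP; rewrite -subr_eq0 -gramPE rPQ.
  by ring.
(* A Hermitian idempotent is its own Gram matrix, hence the positive square root of [Q Q ^t*]. *)
have eqBQ : B = Q.
  have hQQ : Q ^t* = Q by rewrite -eqPQ hP.1.
  apply: psd_sqrt_unique => //; last by rewrite BB hQQ.
  by rewrite -hQ -{1}hQQ; apply: psdmx_gram.
rewrite mxtrace_gram_matched_projB eqPQ eqBQ hQ subrr mul0mx mxtrace0.
by rewrite subrr add0r subrr mulr0.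
Qed.

End Dominating.
End MatchedProjection.
End HilbertSchmidt.

(** * Transfer to the real Frobenius norm *)

Lemma frobnorm_sqrE (R : realType) m n (A : 'M[R[i]]_(m, n)) :
  ((frobnorm A ^+ 2)%:C)%C = \tr (A *m A ^t*).
Proof.
rewrite sqr_sqrtr; last by do 2!apply: sumr_ge0 => ? _; exact: sqr_ge0.
rewrite mxtrace_gramE rmorph_sum; apply: eq_bigr => i _.
by rewrite rmorph_sum; apply: eq_bigr => j _; rewrite rmorphXn.
Qed.

Theorem theorem5p2 (R : realType) (n : nat) (hn : (0 < n)%N)
    (P Q : 'M[R[i]]_n) (hP : projectionmx P) (hQ : idempotentmx Q)
    (hPQ : P *m Q = Q) :
  frobnorm (P - Q) <= Num.sqrt 2 * lambda_PQ P Q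
  /\ (frobnorm (P - Q) = Num.sqrt 2 * lambda_PQ P Q
      <-> P = Q /\ Q = range_proj Q).
Proof.
(* [l] is the real square of lambda; the embedding into [R[i]] reflects order and equality, so the
   trace results descend to it. *)
set l := frobnorm (matched_proj Q - Q) ^+ 2 + (\rank P)%:R - (\rank Q)%:R.
have lC : (l%:C)%C = \tr ((matched_proj Q - Q) *m (matched_proj Q - Q) ^t*)
    + (\rank P)%:R - (\rank Q)%:R.
  by rewrite rmorphB rmorphD !rmorph_nat /= frobnorm_sqrE.
have l2C : ((2 * l)%:C)%C = 2 * (l%:C)%C by rewrite rmorphM rmorph_nat.
have l0 : 0 <= l by rewrite -ler0c lC matched_proj_lambda_ge0.
have nP : 0 <= frobnorm (P - Q) by exact: sqrtr_ge0.
rewrite /lambda_PQ -/l -sqrtrM //.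
split.
  rewrite -(ger0_norm nP) -sqrtr_sqr ler_wsqrtr //.
  by rewrite -lecR frobnorm_sqrE l2C lC matched_proj_bound.
rewrite -matched_proj_bound_eq // -lC -l2C -frobnorm_sqrE; split.
  by move=> ->; rewrite sqr_sqrtr // mulr_ge0.
by move=> /complexI <-; rewrite sqrtr_sqr ger0_norm.
Qed.
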